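(* Let $\Phi\in C_c^2(\mathbb R)$ be positive, $k(Z,Z')=\Phi(u(Z,Z'))$, let $P(v)=\int_v^\infty\Phi(u)\arccos\big(\frac{1-u+2v}{1+u}\big)du$ and $g(\eta)=P(\frac14(e^\eta+e^{-\eta}-2))$. For $a\in\mathbb C$, $b\in\mathbb R$ put $$n(a,b)=\begin{pmatrix}1&a&\frac{|a|^2}{2}+ib\\0&1&\bar a\\0&0&1\end{pmatrix}.$$ Then for $Z,Z'\in\mathfrak S_2$, $$\int_{\mathbb R}\int_{\mathbb C}k(Z,n(a,b)Z')\,da\,d\bar a\,db=2\pi\rho\rho'\,g(\log\rho'-\log\rho),$$ where $\rho=\rho(Z)$, $\rho'=\rho(Z')$.
   Context: $\mathfrak S_2=\{(z_1,z_2)\in\mathbb C^2: z_1+\bar z_1-z_2\bar z_2>0\}$, on which $3\times3$ matrices $g=(g_{ij})$ in $SU(2,1)$ act by $g(z_1,z_2)=\big(\frac{g_{11}z_1+g_{12}z_2+g_{13}}{g_{31}z_1+g_{32}z_2+g_{33}},\frac{g_{21}z_1+g_{22}z_2+g_{23}}{g_{31}z_1+g_{32}z_2+g_{33}}\big)$ (so $n(a,b)(z_1,z_2)=(z_1+az_2+\frac{|a|^2}{2}+ib,\ z_2+\bar a)$). $\rho(Z,W)=\bar z_1+w_1-\bar z_2w_2$, $\rho(Z)=\rho(Z,Z)$, $u(Z,W)=\frac{|\rho(Z,W)|^2}{\rho(Z)\rho(W)}-1$. *)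

(* Defs.v *)
From mathcomp Require Import all_boot all_algebra.
From mathcomp Require Import all_classical all_reals all_analysis.
From mathcomp Require Import complex.
Import GRing.Theory Num.Theory numFieldNormedType.Exports.
Local Open Scope ring_scope.

Section Defs.
Variable R : realType.

Definition pt := (R[i] * R[i])%type.

Definition inS2 (Z : pt) : Prop := 0 < Z.1 + (Z.1)^*%C - Z.2 * (Z.2)^*%C.

Definition rho2 (Z W : pt) : R[i] := (Z.1)^*%C + W.1 - (Z.2)^*%C * W.2.

(* rho(Z) = rho(Z,Z), which is real *)
Definition rho (Z : pt) : R := complex.Re (rho2 Z Z).

Definition uu (Z W : pt) : R := complex.Re (`|rho2 Z W| ^+ 2) / (rho Z * rho W) - 1.

Definition act (g : 'M[R[i]]_3) (Z : pt) : pt :=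
  let e := fun i j : nat => g (inord i) (inord j) in
  let den := e 2%N 0%N * Z.1 + e 2%N 1%N * Z.2 + e 2%N 2%N in
  ((e 0%N 0%N * Z.1 + e 0%N 1%N * Z.2 + e 0%N 2%N) / den,
   (e 1%N 0%N * Z.1 + e 1%N 1%N * Z.2 + e 1%N 2%N) / den).

Definition nmat (a : R[i]) (b : R) : 'M[R[i]]_3 :=
  \matrix_(i < 3, j < 3)
    match nat_of_ord i, nat_of_ord j with
    | 0, 0 => 1
    | 0, 1 => a
    | 0, 2 => `|a| ^+ 2 / 2 + 'i%C * b%:C%C
    | 1, 1 => 1
    | 1, 2 => a^*%C
    | 2, 2 => 1
    | _, _ => 0
    end.

Definition C2c (f : R -> R) : Prop :=
  [/\ (forall x, derivable f x 1),
      (forall x, derivable (derive1 f) x 1),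
      continuous (derive1n 2 f : R -> R) &
      exists M : R, forall x, M < `|x| -> f x = 0].

Definition kern (Phi : R -> R) (Z W : pt) : R := Phi (uu Z W).

Definition Pfun (Phi : R -> R) (v : R) : \bar R :=
  (\int[lebesgue_measure]_(t in `[v, +oo[%classic)
     (Phi t * acos ((1 - t + 2 * v) / (1 + t)))%:E)%E.

Definition gfun (Phi : R -> R) (eta : R) : \bar R :=
  Pfun Phi ((expR eta + expR (- eta) - 2) / 4).

(* int_R int_C k(Z, n(a,b) Z') da dabar db, with da dabar = 2 dx dy (a = x + i y) *)
Definition Nintegral (Phi : R -> R) (Z W : pt) : \bar R :=
  (\int[lebesgue_measure]_b \int[lebesgue_measure]_x \int[lebesgue_measure]_y
     (2 * kern Phi Z (act (nmat (Complex x y) b) W))%:E)%E.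

End Defs.

Arguments inS2 {R}.
Arguments rho2 {R}.
Arguments rho {R}.
Arguments uu {R}.
Arguments act {R}.
Arguments nmat {R}.
Arguments C2c {R}.
Arguments kern {R}.
Arguments Pfun {R}.
Arguments gfun {R}.
Arguments Nintegral {R}.

(* Main.v *)
Require Import Defs.
From mathcomp Require Import all_boot all_order all_algebra.
From mathcomp Require Import all_classical all_reals all_analysis.
From mathcomp Require Import measurable_realfun.
From mathcomp Require Import complex.
From mathcomp Require Import ring lra.
Import Order.TTheory GRing.Theory Num.Theory numFieldNormedType.Exports.
Local Open Scope classical_set_scope.
Local Open Scope ring_scope.

(** Completing the square in [a], the squared modulus of [rho(Z, n(a,b) Z')] is
    [((|a + a0|^2 + s) / 2)^2 + (b + L(a))^2] with [s = rho + rho'] and [L] real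
    affine, so a shear and a translation of [(a, b)] reduce the integral to
    [Phi ((((|a|^2 + s) / 2)^2 + b^2) / D - 1)] with [D = rho rho'].  Radial
    integration in [a] turns it into [4 pi D] times the integral of
    [Phi (q^2 + b^2 - 1)] over the half-plane [q >= c], [c = s / (2 sqrt D)];
    there the circle of radius [sqrt t] is cut in an arc of half-angle
    [arccos (c / sqrt t) = atan (sqrt (t / c^2 - 1))], which is half of the
    [arccos] in [P], and [c^2 - 1] is the argument of [P] in [g]. *)

(** * Substitutions on half-lines *)

Section Substitution.
Variable R : realType.
Notation mu := (@lebesgue_measure R).
Local Open Scope ereal_scope.

(** The image of Lebesgue measure under [x -> a x + c], rescaled by [a], gives each half-open
    interval its length, so by uniqueness it is Lebesgue measure. *)
Lemma ge0_integration_by_affine_substitution (a c : R) (f : R -> \bar R) :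
  (0 < a)%R -> measurable_fun setT f -> (forall x, 0 <= f x) ->
  \int[mu]_x f x = a%:E * \int[mu]_x f (a * x + c)%R.
Proof.
move=> ap mf f0.
pose phi : R -> measurableTypeR R := fun x => (a * x + c)%R.
have mphi : measurable_fun setT phi.
  by apply: measurable_funD => //; exact: measurable_funM.
(* The pushforward is a measure by [mphi]; [m] bundles it with that structure so that [mscale]
   applies. *)
have : exists m : {measure set (measurableTypeR R) -> \bar R},
    m = pushforward mu phi :> (_ -> _).
  by unshelve eexists (pushforward mu phi).
move=> [m mE].
transitivity (\int[mscale (NngNum (ltW ap)) m]_x f x).
  apply: eq_measure_integral => A mA _.
  apply: lebesgue_measure_unique mA => X [[l r] _ <-].
  rewrite /= /mscale/= mE /pushforward.
  have -> : phi @^-1` `]l, r] = `]((l - c) / a)%R, ((r - c) / a)%R]%classic.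
    by apply/seteqP; split => x /=; rewrite !in_itv/= /phi
      ltr_pdivrMr// ler_pdivlMr// ltrBlDr lerBrDr mulrC.
  rewrite !lebesgue_measure_itv/= !lte_fin ltr_pM2r ?invr_gt0// ltrD2r.
  case: ifPn => _; last by rewrite mule0.
  by rewrite -!EFinB -EFinM; congr EFin; field; rewrite lt0r_neq0.
rewrite ge0_integral_mscale//=; congr (_ * _).
transitivity (\int[pushforward mu phi]_x f x); first by rewrite -mE.
by rewrite ge0_integral_pushforward// preimage_setT.
Qed.

Lemma ge0_integral_itvcy_affine (a c : R) (f : R -> \bar R) :
  (0 < a)%R -> measurable_fun setT f -> (forall x, 0 <= f x) ->
  forall l, \int[mu]_(x in `[(a * l + c)%R, +oo[) f x =
            a%:E * \int[mu]_(x in `[l, +oo[) f (a * x + c)%R.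
Proof.
move=> a0 mf f0 l; rewrite integral_mkcond.
rewrite (ge0_integration_by_affine_substitution a c)//; last 2 first.
- by apply/(measurable_restrictT _ _).1 => //; exact: measurable_funTS.
- by move=> x; apply: erestrict_ge0.
congr (_ * _); rewrite [RHS]integral_mkcond; apply: eq_integral => x _.
by rewrite !patchE !mem_setE/= !in_itv/= !andbT lerD2r ler_pM2l.
Qed.

(** Squaring is increasing on each [[c, c + n]], where the substitution theorem on segments applies;
    these segments and their images exhaust the two half-lines, and monotone convergence passes to
    the limit. *)
Lemma ge0_integral_itvcy_sqr (c : R) (f : R -> R) :
  (0 <= c)%R -> continuous f -> (forall x, 0 <= f x)%R ->
  \int[mu]_(t in `[(c ^+ 2)%R, +oo[) (f t)%:E =
  \int[mu]_(q in `[c, +oo[) (2 * q * f (q ^+ 2))%:E.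
Proof.
move=> c0 cf f0.
pose F n : set R := `[c, (c + n%:R)%R]%classic.
pose G n : set R := `[(c ^+ 2)%R, ((c + n%:R) ^+ 2)%R]%classic.
have UF : \bigcup_n F n = `[c, +oo[%classic.
  apply/seteqP; split=> [x [n _]|x]; rewrite /F/= !in_itv/= ?andbT.
    by move=> /andP[].
  move=> cx.
  by exists (Num.trunc (x - c)).+1 => //=; rewrite in_itv/= cx -lerBlDl ltW// truncnS_gt.
have UG : \bigcup_n G n = `[(c ^+ 2)%R, +oo[%classic.
  apply/seteqP; split=> [x [n _]|x]; rewrite /G/= !in_itv/= ?andbT.
    by move=> /andP[].
  move=> cx.
  have x0 : (0 <= x)%R by rewrite (le_trans _ cx)// sqr_ge0.
  exists (Num.trunc (Num.sqrt x - c)).+1 => //=; rewrite in_itv/= cx/=.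
  rewrite -{1}(sqr_sqrtr x0) ler_sqr ?nnegrE ?sqrtr_ge0 ?addr_ge0//.
  by rewrite -lerBlDl ltW// truncnS_gt.
rewrite -UF -UG.
have FG n : \int[mu]_(t in G n) (f t)%:E =
    \int[mu]_(q in F n) (2 * q * f (q ^+ 2))%:E.
  pose S : R -> R := fun x => (x ^+ 2)%R.
  have S' : (derive1 S) = (fun x => 2 * x)%R.
    by apply/funext => x; rewrite /S exp_derive1 expr1.
  have cS' : continuous (derive1 S).
    by rewrite S' => x; apply: cvgM; [exact: cvg_cst|exact: cvg_id].
  have cS : continuous S by exact: exprn_continuous.
  rewrite /G (@integration_by_substitution_increasing _ S f c (c + n%:R)%R).
  - by apply: eq_integral => x _; rewrite S' mulrfctE/= mulrC.
  - by rewrite lerDl.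
  - move=> x y; rewrite !in_itv/= => /andP[cx _] /andP[cy _] xy.
    by rewrite /S ltr_sqr// nnegrE (le_trans c0).
  - by move=> x _; exact: cS'.
  - by apply/cvg_ex; eexists; apply: cvg_at_right_filter; exact: cS'.
  - by apply/cvg_ex; eexists; apply: cvg_at_left_filter; exact: cS'.
  - split=> [x _||]; [exact: exprn_derivable| |].
    + by apply: cvg_at_right_filter; exact: cS.
    + by apply: cvg_at_left_filter; exact: cS.
  - exact: continuous_subspaceT.
have mf : measurable_fun setT f by exact: continuous_measurable_fun.
have cF : \int[mu]_(q in F n) (2 * q * f (q ^+ 2))%:E @[n --> \oo] -->
    \int[mu]_(q in \bigcup_n F n) (2 * q * f (q ^+ 2))%:E.
  apply: ge0_nondecreasing_set_cvg_integral => //.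
  - move=> m n mn; apply/subsetPset => x; rewrite /F/= !in_itv/= => /andP[-> xm]/=.
    by rewrite (le_trans xm)// lerD2l ler_nat.
  - by move=> n; exact: measurable_itv.
  - move=> n; apply/measurable_funTS/measurable_EFinP.
    apply: measurable_funM; first exact: measurable_funM.
    by apply: measurableT_comp => //; exact: measurable_funX.
  - move=> n x; rewrite /F/= in_itv/= => /andP[cx _].
    by rewrite lee_fin !mulr_ge0// (le_trans c0).
have cG : \int[mu]_(t in G n) (f t)%:E @[n --> \oo] -->
    \int[mu]_(t in \bigcup_n G n) (f t)%:E.
  apply: ge0_nondecreasing_set_cvg_integral => //.
  - move=> m n mn; apply/subsetPset => x; rewrite /G/= !in_itv/= => /andP[-> xm]/=.
    by rewrite (le_trans xm)// ler_sqr ?nnegrE ?addr_ge0// lerD2l ler_nat.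
  - by move=> n; exact: measurable_itv.
  - by move=> n; exact/measurable_funTS/measurable_EFinP.
  - by move=> n x _; rewrite lee_fin.
have FGE : (fun n => \int[mu]_(t in G n) (f t)%:E) =
    (fun n => \int[mu]_(q in F n) (2 * q * f (q ^+ 2))%:E) by exact/funext.
by rewrite FGE in cG; exact: cvg_unique cG cF.
Qed.
End Substitution.

(** * Tonelli on product domains and slope coordinates *)

Section SlopeCoordinates.
Variable R : realType.
Notation mu := (@lebesgue_measure R).
Local Open Scope ereal_scope.

(** Extending [f] by zero outside the rectangle reduces this to Tonelli on the whole plane. *)
Lemma integral_tonelli_in (D E : set R) (f : R * R -> \bar R) :
  measurable D -> measurable E -> measurable_fun setT f -> (forall x, 0 <= f x) ->
  \int[mu]_(x in D) \int[mu]_(y in E) f (x, y) =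
  \int[mu]_(y in E) \int[mu]_(x in D) f (x, y).
Proof.
move=> mD mE mf f0.
pose g := (f \_ (D `*` E)) : R * R -> \bar R.
have mg : measurable_fun setT g.
  by apply/(measurable_restrictT _ _).1; [exact: measurableX|exact: measurable_funTS].
have g0 x : 0 <= g x by apply: erestrict_ge0.
transitivity (\int[mu]_x \int[mu]_y g (x, y)).
  rewrite integral_mkcond; apply: eq_integral => x _.
  rewrite [LHS]patchE; case: ifPn => xD.
    rewrite integral_mkcond; apply: eq_integral => y _.
    by rewrite /g !patchE in_setX xD.
  by rewrite integral0_eq// => y _; rewrite /g patchE in_setX (negbTE xD).
rewrite (fubini_tonelli g mg g0 (m1 := mu) (m2 := mu)).
rewrite [RHS]integral_mkcond; apply: eq_integral => y _.
rewrite [RHS]patchE; case: ifPn => yE.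
  rewrite [RHS]integral_mkcond; apply: eq_integral => x _.
  by rewrite /g !patchE in_setX yE andbT.
by apply: integral0_eq => x _; rewrite /g patchE in_setX (negbTE yE) andbF.
Qed.

Lemma measurable_integral_in (E : set R) (f : R * R -> \bar R) :
  measurable E -> measurable_fun setT f -> (forall x, 0 <= f x) ->
  measurable_fun setT (fun x => \int[mu]_(y in E) f (x, y)).
Proof.
move=> mE mf f0.
pose g := (f \_ (setT `*` E)) : R * R -> \bar R.
have mg : measurable_fun setT g.
  by apply/(measurable_restrictT _ _).1; [exact: measurableX|exact: measurable_funTS].
have g0 x : 0 <= g x by apply: erestrict_ge0.
have := measurable_fun_fubini_tonelli_F g mg g0 (m2 := mu).
rewrite /fubini_F; congr measurable_fun; apply/funext => x.
rewrite [RHS]integral_mkcond; apply: eq_integral => y _.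
by rewrite /g !patchE in_setX in_setT.
Qed.

(* Instead of polar coordinates, [b = q m] with slope [m] followed by
   [t = q^2 (1 + m^2)]: both substitutions are one-dimensional. *)
Lemma integral_quadrant_slope (c : R) (f : R -> R) :
  (0 <= c)%R -> continuous f -> (forall x, 0 <= f x)%R ->
  \int[mu]_(q in `[c, +oo[) \int[mu]_(b in `[0%R, +oo[) (f (q ^+ 2 + b ^+ 2))%:E =
  \int[mu]_(m in `[0%R, +oo[) ((2 * oneDsqr m)^-1%:E *
    \int[mu]_(t in `[(oneDsqr m * c ^+ 2)%R, +oo[) (f t)%:E).
Proof.
move=> c0 cf f0.
have mf : measurable_fun setT f by exact: continuous_measurable_fun.
have mfst : measurable_fun setT (fst : R * R -> R) by [].
have msnd : measurable_fun setT (snd : R * R -> R) by [].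
pose F (p : R * R) := (f (p.1 ^+ 2 + p.2 ^+ 2))%:E.
have mF : measurable_fun setT F.
  apply/measurable_EFinP/measurableT_comp => //.
  by apply: measurable_funD; exact: measurable_funX.
(* The factor [q] is the Jacobian of [b = q m]; the absolute value keeps [H] nonnegative on the
   whole plane. *)
pose H (p : R * R) := (`|p.1| * f (p.1 ^+ 2 * oneDsqr p.2))%:E.
have mH : measurable_fun setT H.
  apply/measurable_EFinP/measurable_funM; first exact: measurableT_comp.
  apply: measurableT_comp => //; apply: measurable_funM; first exact: measurable_funX.
  by apply: measurable_funD => //; exact: measurable_funX.
have F0 p : 0 <= F p by rewrite lee_fin.
have H0 p : 0 <= H p by rewrite lee_fin mulr_ge0.
transitivity (\int[mu]_(q in `[c, +oo[) \int[mu]_(m in `[0%R, +oo[) H (q, m)).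
  (* The endpoint [q = c] is dropped because [c] may be 0, while [b = q m] requires [q > 0]. *)
  rewrite -integral_itv_obnd_cbnd; last first.
    by apply: measurable_funTS; apply: (measurable_integral_in _ F).
  rewrite -[RHS]integral_itv_obnd_cbnd; last first.
    by apply: measurable_funTS; apply: (measurable_integral_in _ H).
  apply: eq_integral => q; rewrite inE/= in_itv/= andbT => cq.
  have q0 : (0 < q)%R by exact: le_lt_trans cq.
  have := @ge0_integral_itvcy_affine R q 0 (fun y => F (q, y)) q0 _ _ 0.
  rewrite mulr0 addr0 => -> //; last exact: measurableT_comp.
  rewrite -ge0_integralZl//; last 2 first.
  - apply/measurable_funTS; rewrite /F/=.
    apply/measurable_EFinP/measurableT_comp => //; apply: measurable_funD => //.
    apply: measurable_funX; apply: measurable_funD => //; exact: measurable_funM.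
  - by rewrite lee_fin ltW.
  apply: eq_integral => m _; rewrite /F /H/= -EFinM gtr0_norm// addr0.
  by rewrite /oneDsqr mulrDr mulr1 exprMn.
rewrite (integral_tonelli_in _ _ H)//.
apply: eq_integral => m; rewrite inE/= in_itv/= andbT => m0.
have w0 : (0 < oneDsqr m :> R)%R by rewrite (lt_le_trans ltr01)// oneDsqr_ge1.
set w := oneDsqr m in w0 *.
(* For a fixed slope, [t = w q^2] is split into a scaling by [w] and the squaring substitution. *)
have := @ge0_integral_itvcy_affine R w 0 (EFin \o f) w0 _ _ (c ^+ 2).
rewrite addr0 => -> //; last exact/measurable_EFinP.
rewrite muleA -EFinM invfM -mulrA mulVf ?lt0r_neq0// mulr1.
under [in RHS]eq_integral do rewrite /= addr0.
rewrite (@ge0_integral_itvcy_sqr R c (fun t => f (w * t)%R))//; last first.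
  by move=> x; apply: continuous_comp; [apply: cvgM; [exact: cvg_cst|exact: cvg_id]|exact: cf].
rewrite -ge0_integralZl//; last 2 first.
- apply/measurable_funTS/measurable_EFinP; apply: measurable_funM; first exact: measurable_funM.
  apply: measurableT_comp => //; apply: measurable_funM => //; exact: measurable_funX.
- move=> x; rewrite /= in_itv/= andbT => cx.
  by rewrite lee_fin !mulr_ge0// (le_trans c0).
apply: eq_integral => q; rewrite inE/= in_itv/= andbT => cq.
rewrite /H/= ger0_norm; last exact: le_trans cq.
by rewrite -EFinM (mulrC w) !mulrA mulVf ?pnatr_eq0 ?mul1r.
Qed.
End SlopeCoordinates.

(** * Radial integrals *)

Section RadialIntegrals.
Variable R : realType.
Notation mu := (@lebesgue_measure R).
Local Open Scope ereal_scope.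

(** Double-angle formula: if [k = tan h], then [cos (2 h) = 2 / (1 + k^2) - 1], and here
    [1 + k^2 = t / c^2]. *)
Lemma acos_double_atan (c t : R) : (0 < c -> c ^+ 2 <= t ->
  acos (2 * c ^+ 2 / t - 1) = 2 * atan (Num.sqrt (t / c ^+ 2 - 1)))%R.
Proof.
move=> c0 ct.
have c20 : (0 < c ^+ 2)%R by rewrite exprn_gt0.
have t0 : (0 < t)%R by exact: lt_le_trans ct.
set k := Num.sqrt _.
have k2 : (k ^+ 2 = t / c ^+ 2 - 1)%R.
  by rewrite sqr_sqrtr// subr_ge0 ler_pdivlMr// mul1r.
have k0 : (0 <= atan k)%R by rewrite -(atan0 R); apply: le_atan; rewrite sqrtr_ge0.
have kpi := atan_ltpi2 k.
(* Since [k >= 0], the angle [2 atan k] lies in the range of [acos]. *)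
rewrite -[RHS]cosK; last first.
  rewrite in_itv/=; apply/andP; split; first by rewrite mulr_ge0.
  by move: kpi; lra.
congr acos.
rewrite [X in cos X]mulr_natl cos_mulr2n cos_atan exprVn sqr_sqrtr.
  by rewrite (addrC 1%R) k2 subrK invf_div -mulrA mulr_natl.
by rewrite (addrC 1%R) k2 subrK divr_ge0// ltW.
Qed.

Lemma measurable_oneDsqrV : measurable_fun setT (fun m : R => (oneDsqr m)^-1)%R.
Proof. by apply: continuous_measurable_fun; exact: continuous_oneDsqrV. Qed.

Lemma integral_oneDsqrV (k : R) : (0 <= k)%R ->
  \int[mu]_(m in `[0%R, k]) (oneDsqr m)^-1%:E = (atan k)%:E.
Proof.
move=> k0; rewrite -integral0_oneDsqr// /Rintegral fineK//.
apply: integrable_fin_num => //.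
apply: continuous_compact_integrable; first exact: segment_compact.
by apply: continuous_subspaceT; exact: continuous_oneDsqrV.
Qed.

Lemma integral_sqr_even (q : R) (f : R -> R) :
  continuous f -> (forall x, 0 <= f x)%R ->
  \int[mu]_b (f (q ^+ 2 + b ^+ 2))%:E =
  2%:E * \int[mu]_(b in `[0%R, +oo[) (f (q ^+ 2 + b ^+ 2))%:E.
Proof.
move=> cf f0; rewrite ge0_symfun_integralT//.
- by rewrite set_itvcy.
- move=> x; apply: continuous_comp; last exact: cf.
  by apply: cvgD; [exact: cvg_cst|exact: exprn_continuous].
- by move=> x /=; rewrite sqrrN.
Qed.

Lemma measurable_sqr_sum (f : R -> R) : measurable_fun setT f ->
  measurable_fun setT (fun p : R * R => (f (p.1 ^+ 2 + p.2 ^+ 2))%:E).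
Proof.
move=> mf; apply/measurable_EFinP/measurableT_comp => //.
by apply: measurable_funD; apply: measurable_funX.
Qed.

(** Folding both axes gives 4 times the quadrant. In slope coordinates with [c = 0] the integral in
    [t] is independent of the slope, and [1 / (2 (1 + m^2))] integrates to [pi / 4]. *)
Lemma integral_plane_radial (f : R -> R) :
  continuous f -> (forall x, 0 <= f x)%R ->
  \int[mu]_x \int[mu]_y (f (x ^+ 2 + y ^+ 2))%:E =
  pi%:E * \int[mu]_(t in `[0%R, +oo[) (f t)%:E.
Proof.
move=> cf f0.
have mf : measurable_fun setT f by exact: continuous_measurable_fun.
have mF := measurable_sqr_sum _ mf.
set F := (fun p : R * R => _) in mF.
have F0 p : 0 <= F p by rewrite lee_fin.
have I0 : 0 <= \int[mu]_(t in `[0%R, +oo[) (f t)%:E.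
  by apply: integral_ge0 => t _; rewrite lee_fin.
under eq_integral do rewrite integral_sqr_even//.
rewrite ge0_integralZl//; last 2 first.
- exact: (measurable_integral_in _ _ F).
- by move=> x _; apply: integral_ge0 => y _; rewrite lee_fin.
rewrite (integral_tonelli_in _ _ _ F)//.
(* Now that [x] is the inner variable, it can be folded in its turn. *)
have -> : \int[mu]_(y in `[0%R, +oo[) \int[mu]_x F (x, y) =
    \int[mu]_(y in `[0%R, +oo[) (2%:E * \int[mu]_(x in `[0%R, +oo[) F (y, x)).
  apply: eq_integral => y _; rewrite -integral_sqr_even//.
  by apply: eq_integral => x _; rewrite /F/= addrC.
rewrite ge0_integralZl//; last 2 first.
- by apply: measurable_funTS; exact: (measurable_integral_in _ _ F).
- by move=> x _; apply: integral_ge0 => y _; rewrite lee_fin.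
rewrite (integral_quadrant_slope _ 0)//.
under eq_integral do rewrite expr0n/= mulr0 invfM EFinM -muleA.
rewrite ge0_integralZl//; last 2 first.
- apply: emeasurable_funM => //; apply/measurable_EFinP.
  by apply: measurable_funTS; apply: measurable_oneDsqrV.
- by move=> m _; apply: mule_ge0 => //; rewrite lee_fin invr_ge0.
rewrite ge0_integralZr//; last first.
  apply/measurable_EFinP.
  by apply: measurable_funTS; apply: measurable_oneDsqrV.
rewrite integral0y_oneDsqr !muleA -!EFinM; congr (_%:E * _).
by field.
Qed.

(** With the order of slope and [t] exchanged, the slopes allowed for a given [t] satisfy
    [(1 + m^2) c^2 <= t], that is [m <= sqrt (t / c^2 - 1)], and [1 / (1 + m^2)] integrates to the
    half-angle of the arc. *)
Lemma integral_halfplane_radial (c : R) (f : R -> R) :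
  (0 < c)%R -> continuous f -> (forall x, 0 <= f x)%R ->
  \int[mu]_(q in `[c, +oo[) \int[mu]_b (f (q ^+ 2 + b ^+ 2))%:E =
  \int[mu]_(t in `[(c ^+ 2)%R, +oo[)
    (f t * atan (Num.sqrt (t / c ^+ 2 - 1)))%:E.
Proof.
move=> c0 cf f0.
have c20 : (0 < c ^+ 2)%R by rewrite exprn_gt0.
have mf : measurable_fun setT f by exact: continuous_measurable_fun.
have mF := measurable_sqr_sum _ mf.
set F := (fun p : R * R => _) in mF.
have F0 p : 0 <= F p by rewrite lee_fin.
have w0 m : (0 < oneDsqr m :> R)%R by rewrite (lt_le_trans ltr01)// oneDsqr_ge1.
under eq_integral do rewrite integral_sqr_even//.
rewrite ge0_integralZl//; last 2 first.
- by apply: measurable_funTS; exact: (measurable_integral_in _ _ F).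
- by move=> x _; apply: integral_ge0 => y _; rewrite lee_fin.
rewrite integral_quadrant_slope//; last exact: ltW.
(* The bound on [t] depends on [m]; moving it into the integrand makes the domain a product, as
   Tonelli requires. *)
pose H (p : R * R) := (if oneDsqr p.1 * c ^+ 2 <= p.2 then
  (2 * oneDsqr p.1)^-1 * f p.2 else 0)%R%:E.
have mw : measurable_fun setT (fun p : R * R => oneDsqr p.1).
  by apply: measurable_funD => //; apply: measurable_funX.
have mH : measurable_fun setT H.
  apply/measurable_EFinP; apply: measurable_fun_ifT => //.
    by apply: measurable_fun_ler => //; exact: measurable_funM.
  apply: measurable_funM; last exact: measurableT_comp.
  rewrite [X in measurable_fun _ X](_ : _ =
    (fun p : R * R => (2^-1 * (oneDsqr p.1)^-1)%R)); last first.
    by apply/funext => p; rewrite invfM.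
  apply: measurable_funM => //.
  exact: (measurableT_comp measurable_oneDsqrV).
have H0 p : 0 <= H p.
  by rewrite lee_fin; case: ifPn => // _; rewrite mulr_ge0// invr_ge0 mulr_ge0// ltW.
transitivity (2%:E * \int[mu]_(m in `[0%R, +oo[) \int[mu]_t H (m, t)).
  congr (_ * _); apply: eq_integral => m _.
  rewrite -ge0_integralZl//; last 2 first.
  - by apply: measurable_funTS; exact/measurable_EFinP.
  - by move=> t _; rewrite lee_fin.
  rewrite integral_mkcond; apply: eq_integral => t _.
  by rewrite patchE mem_setE/= in_itv/= andbT /H/=; case: ifPn.
rewrite (integral_tonelli_in _ _ _ H)// -ge0_integralZl//; last 2 first.
- apply: (measurable_integral_in _ _ (fun p : R * R => H (p.2, p.1))) => //.
  by apply: (measurableT_comp mH); exact: measurable_fun_pair.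
- by move=> x _; apply: integral_ge0.
rewrite [RHS]integral_mkcond; apply: eq_integral => t _.
rewrite [RHS]patchE mem_setE/= in_itv/= andbT; case: ifPn => ct; last first.
  (* Below [c^2] no slope is allowed, as [oneDsqr m >= 1]. *)
  rewrite integral0_eq ?mule0// => m _; rewrite /H/= ifF//.
  apply/negbTE; apply: contra ct => /(le_trans _); apply.
  by rewrite ler_peMl ?oneDsqr_ge1// ltW.
pose k := Num.sqrt (t / c ^+ 2 - 1).
have k0 : (0 <= k)%R by exact: sqrtr_ge0.
transitivity (2%:E * \int[mu]_(m in `[0%R, k]) ((2^-1 * f t)%:E * (oneDsqr m)^-1%:E)).
  congr (_ * _); rewrite integral_mkcond [RHS]integral_mkcond.
  apply: eq_integral => m _; rewrite !patchE !mem_setE/= !in_itv/= andbT.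
  case: ifPn => //= m0; rewrite /H/=.
  have -> : (oneDsqr m * c ^+ 2 <= t)%R = (m <= k)%R.
    rewrite -ler_pdivlMr// /oneDsqr -lerBrDl -[RHS]ler_sqr ?nnegrE// sqr_sqrtr//.
    by rewrite subr_ge0 ler_pdivlMr// mul1r.
  by case: ifPn => // _; rewrite -EFinM invfM mulrAC.
rewrite ge0_integralZl//; last 2 first.
- apply/measurable_funTS/measurable_EFinP.
  by apply: measurable_oneDsqrV.
- by rewrite lee_fin mulr_ge0.
rewrite integral_oneDsqrV// -!EFinM; congr EFin.
by field.
Qed.
End RadialIntegrals.

(** * Shears of the Heisenberg group *)

Section Shear.
Variable R : realType.
Notation mu := (@lebesgue_measure R).
Local Open Scope ereal_scope.

Lemma ge0_integral_shift (c : R) (f : R -> \bar R) :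
  measurable_fun setT f -> (forall x, 0 <= f x) ->
  \int[mu]_x f (x + c)%R = \int[mu]_x f x.
Proof.
move=> mf f0; rewrite [RHS](ge0_integration_by_affine_substitution _ 1 c)// mul1e.
by apply: eq_integral => x _; rewrite mul1r.
Qed.

(** Two exchanges, [b] with [x] and then [b] with [y], make the central variable innermost. *)
Lemma integral_rotate3 (M : (R * R) * R -> \bar R) :
  measurable_fun setT M -> (forall p, 0 <= M p) ->
  \int[mu]_b \int[mu]_x \int[mu]_y M ((x, y), b) =
  \int[mu]_x \int[mu]_y \int[mu]_b M ((x, y), b).
Proof.
move=> mM M0.
have mM1 : measurable_fun setT (fun q : (R * R) * R => M ((q.1.2, q.2), q.1.1)).
  apply: (measurableT_comp mM).
  apply: measurable_fun_pair; first apply: measurable_fun_pair => //.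
    exact: (measurableT_comp _ measurable_fst).
  exact: (measurableT_comp _ measurable_fst).
pose g (p : R * R) := \int[mu]_y M ((p.2, y), p.1).
have mg : measurable_fun setT g.
  have M10 (q : (R * R) * R) : 0 <= M ((q.1.2, q.2), q.1.1) by exact: M0.
  exact: (measurable_fun_fubini_tonelli_F _ mM1 M10 (m2 := mu)).
have g0 p : 0 <= g p by apply: integral_ge0 => y _; exact: M0.
transitivity (\int[mu]_x \int[mu]_b g (b, x)).
  exact: (integral_tonelli_in _ setT setT g measurableT measurableT mg g0).
apply: eq_integral => x _.
have mMx : measurable_fun setT (fun p : R * R => M ((x, p.2), p.1)).
  apply: (measurableT_comp mM).
  by apply: measurable_fun_pair => //; exact: measurable_fun_pair.
by apply: (integral_tonelli_in _ setT setT _ measurableT measurableT mMx) => p; exact: M0.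
Qed.

(** With [b] innermost, [L (x, y)] is a constant shift, removed by translation invariance; the
    shifts of [y] and [x] follow in the same way. *)
Lemma integral_shear (K : (R * R) * R -> \bar R) (L : R * R -> R) (x0 y0 : R) :
  measurable_fun setT K -> (forall p, 0 <= K p) -> measurable_fun setT L ->
  \int[mu]_b \int[mu]_x \int[mu]_y K ((x + x0, y + y0), b + L (x, y))%R =
  \int[mu]_b \int[mu]_x \int[mu]_y K ((x, y), b).
Proof.
move=> mK K0 mL.
pose K1 (p : (R * R) * R) := K ((p.1.1 + x0, p.1.2 + y0), p.2 + L p.1)%R.
have K10 p : 0 <= K1 p by exact: K0.
have mK1 : measurable_fun setT K1.
  apply: (measurableT_comp mK); apply: measurable_fun_pair.
    apply: measurable_fun_pair; apply: measurable_funD => //;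
    exact: (measurableT_comp _ measurable_fst).
  apply: measurable_funD => //; exact: (measurableT_comp mL).
transitivity (\int[mu]_x \int[mu]_y \int[mu]_b K1 ((x, y), b)).
  exact: (integral_rotate3 K1 mK1 K10).
rewrite (integral_rotate3 K mK K0).
pose g p := \int[mu]_b K (p, b).
have mg : measurable_fun setT g by exact: (measurable_fun_fubini_tonelli_F _ mK K0 (m2 := mu)).
have g0 p : 0 <= g p by apply: integral_ge0.
have mKp p : measurable_fun setT (fun b => K (p, b)).
  by apply: (measurableT_comp mK); exact: measurable_fun_pair.
transitivity (\int[mu]_x \int[mu]_y g (x + x0, y + y0)%R).
  apply: eq_integral => x _; apply: eq_integral => y _ /=.
  exact: (ge0_integral_shift (L (x, y)) _ (mKp (x + x0, y + y0)%R) (fun b => K0 _)).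
transitivity (\int[mu]_x \int[mu]_y g (x + x0, y)%R).
  apply: eq_integral => x _.
  apply: (ge0_integral_shift _ (fun y => g ((x + x0)%R, y))) => //.
  by apply: (measurableT_comp mg); exact: measurable_fun_pair.
apply: (ge0_integral_shift _ (fun x => \int[mu]_y g (x, y))).
  exact: (measurable_fun_fubini_tonelli_F _ mg g0 (m2 := mu)).
by move=> x; apply: integral_ge0.
Qed.

End Shear.

(** * The kernel along an orbit of N *)

Section Kernel.
Variable R : realType.

Lemma act_nmat (x y b r1 s1 r2 s2 : R) :
  act (nmat (Complex x y) b) (Complex r1 s1, Complex r2 s2) =
  (Complex (r1 + (x * r2 - y * s2) + (x ^+ 2 + y ^+ 2) / 2)
           (s1 + (x * s2 + y * r2) + b),
   Complex (r2 + x) (s2 - y)).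
Proof.
rewrite /act /nmat !mxE !inordK//= !mul0r !mul1r !add0r !divr1.
(* Writing [|a|^2 / 2] as an embedded real lets the components be compared over [R]. *)
rewrite -add_Re2_Im2/= -[2](rmorph_nat (@real_complex R)) -fmorph_div/=.
congr (Complex _ _, _); ring.
Qed.

Lemma rhoE (x1 y1 x2 y2 : R) :
  rho (Complex x1 y1, Complex x2 y2) = 2 * x1 - (x2 ^+ 2 + y2 ^+ 2).
Proof. rewrite /rho /rho2/=; ring. Qed.

Lemma inS2_rho_gt0 (Z : pt R) : inS2 Z -> 0 < rho Z.
Proof.
case: Z => -[x1 y1] [x2 y2]; rewrite rhoE /inS2 ltcE/= => /andP[_].
suff -> : x1 + x1 - (x2 * x2 - y2 * - y2) = 2 * x1 - (x2 ^+ 2 + y2 ^+ 2) by [].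
ring.
Qed.

(** The square is completed by [2 Re rho(Z, W) = rho Z + rho W + |z2 - w2|^2], applied with
    [n(a,b) W] in place of [W]; [rho] is invariant under N, and [Im rho(Z, n(a,b) W)] is [b] plus an
    affine function of [a]. *)
Lemma kern_nmat (Phi : R -> R) (Z W : pt R) : exists x0 y0 al be ga : R,
  forall x y b, kern Phi Z (act (nmat (Complex x y) b) W) =
  Phi (((((x + x0) ^+ 2 + (y + y0) ^+ 2 + (rho Z + rho W)) / 2) ^+ 2 +
       (b + (al * x + be * y + ga)) ^+ 2) / (rho Z * rho W) - 1).
Proof.
case: Z W => -[p1 q1] [p2 q2] [[r1 s1] [r2 s2]].
(* The first two are the components of the conjugate of [w2 - z2]; the other three are read off from
   the imaginary part. *)
exists (r2 - p2), (q2 - s2), (s2 + q2), (r2 + p2), (s1 - q1 - p2 * s2 + q2 * r2).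
move=> x y b; rewrite /kern act_nmat; congr Phi.
rewrite /uu; congr (_ / (_ * _) - 1); last by rewrite !rhoE; field.
rewrite -add_Re2_Im2 !rhoE /rho2/=; congr (_ ^+ 2 + _ ^+ 2); [by field|by ring].
Qed.

End Kernel.

(** * Evaluation of the integral *)

Section Core.
Variable R : realType.
Notation mu := (@lebesgue_measure R).
Local Open Scope ereal_scope.

(** With [d = sqrt D], radial integration in [(x, y)] gives [pi], the substitution [r + s = 2 d q]
    for [r = x^2 + y^2] gives [2 d], and rescaling [b] by [d] gives [d], together [2 pi D]. *)
Lemma integral_heisenberg_radial (Phi : R -> R) (s D : R) :
  (0 < s)%R -> (0 < D)%R -> continuous Phi -> (forall x, 0 <= Phi x)%R ->
  let c := (s / (2 * Num.sqrt D))%R in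
  \int[mu]_b \int[mu]_x \int[mu]_y
    (Phi ((((x ^+ 2 + y ^+ 2 + s) / 2) ^+ 2 + b ^+ 2) / D - 1))%:E =
  (2 * pi * D)%:E * \int[mu]_(t in `[(c ^+ 2)%R, +oo[)
    (Phi (t - 1) * atan (Num.sqrt (t / c ^+ 2 - 1)))%:E.
Proof.
move=> s0 D0 cPhi Phi0 c.
have d0 : (0 < Num.sqrt D)%R by rewrite sqrtr_gt0.
have d2 : (Num.sqrt D ^+ 2 = D)%R by rewrite sqr_sqrtr// ltW.
set d := Num.sqrt D in c d0 d2 *.
have c0 : (0 < c)%R by rewrite divr_gt0// mulr_gt0.
have mPhi : measurable_fun setT Phi by exact: continuous_measurable_fun.
(* The shift by 1 makes the rescaled argument exactly [q^2 + b^2]. *)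
pose f t := Phi (t - 1)%R.
have cf : continuous f.
  move=> t; apply: continuous_comp; last exact: cPhi.
  by apply: cvgB; [exact: cvg_id|exact: cvg_cst].
have f0 t : (0 <= f t)%R by exact: Phi0.
have mf : measurable_fun setT f by exact: continuous_measurable_fun.
have mF := measurable_sqr_sum _ _ mf.
set F := (fun p : R * R => _) in mF.
have F0 p : 0 <= F p by rewrite lee_fin.
pose J b := \int[mu]_(q in `[c, +oo[) F (b, q).
have mJ : measurable_fun setT J by exact: (measurable_integral_in _ _ F).
have J0 b : 0 <= J b by apply: integral_ge0.
transitivity (\int[mu]_b ((pi * (2 * d))%:E * J (d^-1 * b + 0)%R)).
  apply: eq_integral => b _.
  pose h r := f ((((r + s) / 2) ^+ 2 + b ^+ 2) / D)%R.
  have ch : continuous h.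
    move=> r; apply: continuous_comp; last exact: cf.
    apply: cvgM; last exact: cvg_cst.
    apply: cvgD; last exact: cvg_cst.
    apply: (@continuous_comp _ _ _ (fun r : R => (r + s) / 2)%R (fun r : R => r ^+ 2)%R);
      last exact: exprn_continuous.
    by apply: cvgM; [apply: cvgD; [exact: cvg_id|exact: cvg_cst]|exact: cvg_cst].
  rewrite (integral_plane_radial _ h)//; last by move=> x; exact: f0.
  rewrite EFinM -muleA; congr (_ * _).
  have := @ge0_integral_itvcy_affine R (2 * d) (- s) (EFin \o h) _ _ _ c.
  (* This is the choice of [c]: the endpoint [r = 0] corresponds to [q = c]. *)
  have -> : ((2 * d) * c + - s = 0)%R.
    by rewrite /c; field; rewrite lt0r_neq0.
  move=> -> //; last 3 first.
  - by rewrite mulr_gt0.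
  - by apply/measurable_EFinP; exact: continuous_measurable_fun.
  - by move=> x; rewrite lee_fin f0.
  congr (_ * _); apply: eq_integral => q _; rewrite /F /h/= -d2; congr (f _)%:E.
  by field; rewrite lt0r_neq0.
rewrite ge0_integralZl//; last 2 first.
- apply: (measurableT_comp mJ); apply: measurable_funD => //; exact: measurable_funM.
- by rewrite lee_fin !mulr_ge0 ?pi_ge0// ltW.
have -> : \int[mu]_b J (d^-1 * b + 0)%R = d%:E * \int[mu]_b J b.
  rewrite [in RHS](ge0_integration_by_affine_substitution _ d^-1 0)//; last by rewrite invr_gt0.
  by rewrite muleA -EFinM divff ?lt0r_neq0// mul1e.
rewrite muleA -EFinM; congr (_%:E * _); first by rewrite -d2; ring.
rewrite -integral_halfplane_radial// /J.
rewrite (integral_tonelli_in _ setT _ F)//.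
by apply: eq_integral => q _; apply: eq_integral => b _; rewrite /F/= addrC.
Qed.

(** At [v = c^2 - 1] and [t = u + 1] the argument of [acos] becomes [2 c^2 / t - 1], so
    [acos_double_atan] applies. *)
Lemma Pfun_atan (Phi : R -> R) (c : R) :
  (0 < c)%R -> continuous Phi -> (forall x, 0 <= Phi x)%R ->
  Defs.Pfun Phi (c ^+ 2 - 1) = \int[mu]_(t in `[(c ^+ 2)%R, +oo[)
    (2 * Phi (t - 1) * atan (Num.sqrt (t / c ^+ 2 - 1)))%:E.
Proof.
move=> c0 cPhi Phi0.
have c20 : (0 < c ^+ 2)%R by rewrite exprn_gt0.
have mPhi : measurable_fun setT Phi by exact: continuous_measurable_fun.
pose A t : R := (2 * Phi (t - 1) * atan (Num.sqrt (t / c ^+ 2 - 1)))%R.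
have mA : measurable_fun setT A.
  apply: measurable_funM.
    apply: measurable_funM => //.
    by apply: measurableT_comp => //; exact: measurable_funB.
  apply: measurableT_comp.
    by apply: continuous_measurable_fun => x; exact: continuous_atan.
  apply: measurableT_comp.
    by apply: continuous_measurable_fun; exact: sqrt_continuous.
  by apply: measurable_funB => //; exact: measurable_funM.
have A0 t : 0 <= (EFin \o A) t.
  rewrite lee_fin mulr_ge0 ?mulr_ge0//.
  by rewrite -(atan0 R); apply: le_atan; rewrite sqrtr_ge0.
have := @ge0_integral_itvcy_affine R 1 1 (EFin \o A) ltr01 _ A0 (c ^+ 2 - 1)%R.
rewrite mul1r subrK => ->; last exact/measurable_EFinP.
rewrite mul1e; apply: eq_integral => u; rewrite inE/= in_itv/= andbT => cu.
have u1 : (c ^+ 2 <= u + 1)%R by rewrite -lerBlDr.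
have u0 : (0 < u + 1)%R by exact: lt_le_trans u1.
rewrite mul1r /A addrK mulrAC -acos_double_atan// mulrC; congr (acos _ * _)%:E.
by field; rewrite lt0r_neq0.
Qed.

(** The quotient is [cosh (eta / 2)] for [eta = ln r' - ln r], and both sides equal
    [sinh (eta / 2) ^ 2]. *)
Lemma sqr_cosh_half_ln (r r' : R) : (0 < r -> 0 < r' ->
  ((r + r') / (2 * Num.sqrt (r * r'))) ^+ 2 - 1 =
  (expR (ln r' - ln r) + expR (- (ln r' - ln r)) - 2) / 4)%R.
Proof.
move=> r0 r'0; have D0 : (0 <= r * r')%R by rewrite mulr_ge0// ltW.
rewrite opprB !expRD !expRN !lnK ?posrE// expr_div_n exprMn sqr_sqrtr//.
by field; rewrite !lt0r_neq0.
Qed.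

End Core.

Theorem theorem2p3 (R : realType) (Phi : R -> R) (Z Z' : pt R) :
  C2c Phi -> (forall x, 0 <= Phi x) ->
  inS2 Z -> inS2 Z' ->
  Nintegral Phi Z Z' =
  ((2 * pi * rho Z * rho Z')%:E * gfun Phi (ln (rho Z') - ln (rho Z)))%E.
Proof.
move=> [dPhi _ _ _] Phi0 /inS2_rho_gt0 r0 /inS2_rho_gt0 r'0.
have cPhi : continuous Phi.
  by move=> x; apply: differentiable_continuous; apply/derivable1_diffP; exact: dPhi.
have [x0 [y0 [al [be [ga kE]]]]] := kern_nmat R Phi Z Z'.
set r := rho Z in r0 kE *; set r' := rho Z' in r'0 kE *.
have D0 : 0 < r * r' by rewrite mulr_gt0.
have s0 : 0 < r + r' by rewrite addr_gt0.
have c0 : 0 < (r + r') / (2 * Num.sqrt (r * r')).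
  by rewrite divr_gt0// mulr_gt0// sqrtr_gt0.
rewrite /gfun -(sqr_cosh_half_ln R r r' r0 r'0) (Pfun_atan R Phi _ c0 cPhi Phi0).
rewrite -[X in X%:E]mulrA.
(* The 2 from [da dabar = 2 dx dy] is absorbed here; it matches the 2 of the doubled arctangent in
   [Pfun_atan]. *)
pose f t := 2 * Phi t.
have f0 t : 0 <= f t by rewrite mulr_ge0.
have cf : continuous f by move=> t; apply: cvgM; [exact: cvg_cst|exact: cPhi].
have mf : measurable_fun setT f by exact: continuous_measurable_fun.
pose K (p : (R * R) * R) : \bar R :=
  (f ((((p.1.1 ^+ 2 + p.1.2 ^+ 2 + (r + r')) / 2) ^+ 2 + p.2 ^+ 2) / (r * r') - 1))%:E.
pose L (p : R * R) : R := al * p.1 + be * p.2 + ga.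
have K0 p : (0 <= K p)%E by rewrite lee_fin.
have mL : measurable_fun setT L.
  by do 2 apply: measurable_funD => //; exact: measurable_funM.
have m11 : measurable_fun setT (fun p : (R * R) * R => p.1.1).
  exact: (measurableT_comp _ measurable_fst).
have m12 : measurable_fun setT (fun p : (R * R) * R => p.1.2).
  exact: (measurableT_comp _ measurable_fst).
have mK : measurable_fun setT K.
  apply/measurable_EFinP/measurableT_comp => //; apply: measurable_funB => //.
  apply: measurable_funM => //; apply: measurable_funD; last exact: measurable_funX.
  apply: measurable_funX; apply: measurable_funM => //.
  by do 2 apply: measurable_funD => //; exact: measurable_funX.
set mu := @lebesgue_measure R.
have NE : Nintegral Phi Z Z' =
    (\int[mu]_b \int[mu]_x \int[mu]_y K ((x + x0, y + y0), b + L (x, y))%R)%E.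
  apply: eq_integral => b _; apply: eq_integral => x _; apply: eq_integral => y _.
  by rewrite kE.
rewrite NE (integral_shear R _ L x0 y0 mK K0 mL).
exact: (integral_heisenberg_radial R f _ _ s0 D0 cf f0).
Qed.
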